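(* For all integers $n\ge 2$ and $k\ge 1$ we have $$\int_{-1}^1 \left(L_k + F_k x\sqrt5\right)^{n-2}\left(F_k\sqrt5 + L_k x\right)dx = \frac{2^n}{(n-1)\sqrt5}\left(\frac{L_{kn}}{F_k} - \frac{F_{kn}L_k}{nF_k^2}\right)$$ and $$\int_{-1}^1 \left(L_k + F_k x\sqrt5\right)^{n-2}(1-x)\,dx = \frac{2^n}{(n-1)F_k\sqrt5}\left(-\beta^{(n-1)k} + \frac{F_{nk}}{nF_k}\right).$$
   Context: $\beta=(1-\sqrt5)/2$. The Fibonacci numbers are $F_0=0$, $F_1=1$, $F_n=F_{n-1}+F_{n-2}$, and the Lucas numbers are $L_0=2$, $L_1=1$, $L_n=L_{n-1}+L_{n-2}$. *)

(* Defs.v *)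
From Stdlib Require Import Reals.
From Coquelicot Require Import Coquelicot.

Open Scope R_scope.

Fixpoint fib (n : nat) : nat :=
  match n with
  | O => 0
  | S m => match m with
           | O => 1
           | S p => fib m + fib p
           end
  end.

Fixpoint lucas (n : nat) : nat :=
  match n with
  | O => 2
  | S m => match m with
           | O => 1
           | S p => lucas m + lucas p
           end
  end.

Definition F (n : nat) : R := INR (fib n).
Definition L (n : nat) : R := INR (lucas n).

Definition beta : R := (1 - sqrt 5) / 2.

(* Main.v *)
(** Write [a = alpha^k] and [b = beta^k], so that [L k + F k * sqrt 5 = 2 * a]
    and [L k - F k * sqrt 5 = 2 * b].  Both integrands have the form
    [(A + B x)^m * (C + D x)], which integration by parts handles; at [x = 1]
    and [x = -1] the base [A + B x] is [2 * a] and [2 * b], and Binet's formulas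
    turn the boundary terms [a ^ n - b ^ n] and [a ^ n + b ^ n] back into Fibonacci
    and Lucas numbers. *)

Require Import Defs.
From Stdlib Require Import Reals Lra Lia.
From Coquelicot Require Import Coquelicot.

Open Scope R_scope.

Definition alpha : R := (1 + sqrt 5) / 2.

Lemma sqrt5_sqr : sqrt 5 * sqrt 5 = 5.
Proof. apply sqrt_sqrt; lra. Qed.

Lemma sqrt5_neq0 : sqrt 5 <> 0.
Proof. apply Rgt_not_eq, sqrt_lt_R0; lra. Qed.

(** Drives both Binet inductions, since [alpha] and [beta] are the roots of x^2 = x + 1. *)
Lemma fibonacci_recurrence_pow (x : R) (n : nat) :
  x * x = x + 1 -> x ^ S (S n) = x ^ S n + x ^ n.
Proof.
intros Hx; simpl; rewrite <- Rmult_assoc, Hx; ring.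
Qed.

Lemma alpha_sqr : alpha * alpha = alpha + 1.
Proof. unfold alpha; generalize sqrt5_sqr; nra. Qed.

Lemma beta_sqr : beta * beta = beta + 1.
Proof. unfold beta; generalize sqrt5_sqr; nra. Qed.

Lemma F_SS (n : nat) : F (S (S n)) = F (S n) + F n.
Proof. unfold F; rewrite <- plus_INR; reflexivity. Qed.

Lemma L_SS (n : nat) : L (S (S n)) = L (S n) + L n.
Proof. unfold L; rewrite <- plus_INR; reflexivity. Qed.

Lemma binet_F (n : nat) : sqrt 5 * F n = alpha ^ n - beta ^ n.
Proof.
(* The recurrence looks back two steps, so the induction carries two consecutive indices. *)
enough (H : sqrt 5 * F n = alpha ^ n - beta ^ n /\
            sqrt 5 * F (S n) = alpha ^ S n - beta ^ S n) by apply H.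
induction n as [|n [IH1 IH2]].
- unfold F, alpha, beta; simpl; split; lra.
- split; [exact IH2|].
  rewrite F_SS, (fibonacci_recurrence_pow alpha n alpha_sqr),
    (fibonacci_recurrence_pow beta n beta_sqr); lra.
Qed.

Lemma binet_L (n : nat) : L n = alpha ^ n + beta ^ n.
Proof.
enough (H : L n = alpha ^ n + beta ^ n /\
            L (S n) = alpha ^ S n + beta ^ S n) by apply H.
induction n as [|n [IH1 IH2]].
- unfold L, alpha, beta; simpl; split; lra.
- split; [exact IH2|].
  rewrite L_SS, (fibonacci_recurrence_pow alpha n alpha_sqr),
    (fibonacci_recurrence_pow beta n beta_sqr); lra.
Qed.

Lemma F_pos (n : nat) : (1 <= n)%nat -> 0 < F n.
Proof.
intros Hn; apply (lt_INR 0).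
destruct n as [|n]; [lia|clear Hn].
enough (H : (0 < fib (S n) /\ 0 < fib (S (S n)))%nat) by apply H.
induction n as [|n [IH1 IH2]]; [simpl; lia|].
split; [exact IH2|].
change (0 < fib (S (S n)) + fib (S n))%nat; lia.
Qed.

(** [G] comes from one integration by parts: the power is integrated and [C + D * x] is
    differentiated to the constant [D]; integrating the remaining power gives the second term and
    its factor [B ^ 2]. *)
Lemma is_RInt_pow_affine_mul_affine (A B C D p q : R) (m : nat) : B <> 0 ->
  let G x := (A + B * x) ^ S m * (C + D * x) / (INR (S m) * B)
             - D * (A + B * x) ^ S (S m) / (INR (S m) * INR (S (S m)) * B ^ 2) in
  is_RInt (fun x => (A + B * x) ^ m * (C + D * x)) p q (G q - G p).
Proof.
intros HB G.
apply (is_RInt_derive G).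
- intros x _; unfold G.
  assert (H1 : INR (S m) <> 0) by (apply not_0_INR; lia).
  assert (H2 : INR (S (S m)) <> 0) by (apply not_0_INR; lia).
  auto_derive; [auto|].
  rewrite S_INR in H2; field; auto.
- intros x _; apply (ex_derive_continuous (V := R_NormedModule)).
  auto_derive; auto.
Qed.

Theorem theorem1 (n k : nat) (hn : (2 <= n)%nat) (hk : (1 <= k)%nat) :
  is_RInt
    (fun x : R => (L k + F k * x * sqrt 5) ^ (n - 2) * (F k * sqrt 5 + L k * x))
    (-1) 1
    (2 ^ n / ((INR n - 1) * sqrt 5)
       * (L (k * n) / F k - F (k * n) * L k / (INR n * F k ^ 2)))
  /\
  is_RInt
    (fun x : R => (L k + F k * x * sqrt 5) ^ (n - 2) * (1 - x))
    (-1) 1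
    (2 ^ n / ((INR n - 1) * F k * sqrt 5)
       * (- beta ^ ((n - 1) * k) + F (n * k) / (INR n * F k))).
Proof.
(* With n = m + 2, the truncated differences n - 2 and n - 1 become [m] and [S m]. *)
destruct n as [|[|m]]; [lia|lia|].
replace (S (S m) - 2)%nat with m by lia.
replace (S (S m) - 1)%nat with (S m) by lia.
assert (Hf : F k <> 0) by (apply Rgt_not_eq, F_pos, hk).
pose proof sqrt5_neq0 as Hs.
assert (HB : F k * sqrt 5 <> 0) by (apply Rmult_integral_contrapositive; auto).
assert (H1 : INR (S m) <> 0) by (apply not_0_INR; lia).
assert (H2 : INR (S (S m)) <> 0) by (apply not_0_INR; lia).
assert (Hm : INR (S (S m)) - 1 = INR (S m)) by (rewrite (S_INR (S m)); ring).
assert (Ha : L k + F k * sqrt 5 * 1 = 2 * alpha ^ k)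
  by (generalize (binet_F k) (binet_L k); lra).
assert (Hb : L k + F k * sqrt 5 * -1 = 2 * beta ^ k)
  by (generalize (binet_F k) (binet_L k); lra).
rewrite Hm, (Nat.mul_comm (S (S m)) k), (Nat.mul_comm (S m) k).
assert (HF : F (k * S (S m)) =
             ((alpha ^ k) ^ S (S m) - (beta ^ k) ^ S (S m)) / sqrt 5).
{ rewrite <- !pow_mult, <- binet_F; field; exact Hs. }
assert (HL : L (k * S (S m)) = (alpha ^ k) ^ S (S m) + (beta ^ k) ^ S (S m)).
{ rewrite <- !pow_mult; apply binet_L. }
rewrite HF, HL, (pow_mult beta k (S m)).
split.
- pose proof (is_RInt_pow_affine_mul_affine (L k) (F k * sqrt 5) (F k * sqrt 5) (L k)
                (-1) 1 m HB) as H.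
  cbv beta zeta in H.
  rewrite Ha, Hb in H.
  (* The linear factor changes sign between the endpoints, so the products add up to the Lucas term,
     while the pure powers subtract to the Fibonacci term. *)
  replace (F k * sqrt 5 + L k * 1) with (2 * alpha ^ k) in H by lra.
  replace (F k * sqrt 5 + L k * -1) with (- (2 * beta ^ k)) in H by lra.
  eapply is_RInt_ext; [|evar_last; [exact H|]].
  + intros x _; simpl; f_equal; f_equal; ring.
  + rewrite !Rpow_mult_distr, <- !tech_pow_Rmult; field; auto.
(* The factor 1 - x vanishes at 1 and equals 2 at -1, which leaves the lone power of [beta]. *)
- pose proof (is_RInt_pow_affine_mul_affine (L k) (F k * sqrt 5) 1 (-1)
                (-1) 1 m HB) as H.
  cbv beta zeta in H.
  rewrite Ha, Hb in H.
  eapply is_RInt_ext; [|evar_last; [exact H|]].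
  + intros x _; simpl; f_equal; [f_equal|]; ring.
  + rewrite !Rpow_mult_distr, <- !tech_pow_Rmult; field; auto.
Qed.
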